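(* Let $(A,B)$ be an invertible Jones pair of $n\times n$ complex matrices with $A$ symmetric, let $d^2=n$, and let \[ V=\begin{pmatrix} dA & -dA & B^{(-)} & B^{(-)}\\ -dA & dA & B^{(-)} & B^{(-)}\\ (B^{(-)})^T & (B^{(-)})^T & dA & -dA\\ (B^{(-)})^T & (B^{(-)})^T & -dA & dA \end{pmatrix}. \] Then $V\in\mathcal B=\{\mathcal M(F,G,H) : F\in\mathcal N_A,\ G,H\in\mathcal N_{A,B}\}$.
   Context: All matrices are complex. For $n\times n$ matrices $X,Y$, $X\circ Y$ is the Schur product; if $X$ has no zero entry, $X^{(-)}$ is its Schur inverse, $(X^{(-)})_{ij}=1/X_{ij}$. $e_1,\dots,e_n$ is the standard basis of $\mathbb C^n$. $W$ ($n\times n$) is type-II if $W(W^{(-)})^T=nI$. For a matrix $C$, $X_C(M)=CM$, $\Delta_C(M)=C\circ M$. A Jones pair is a pair $(A,B)$ of $n\times n$ matrices with $X_A$, $\Delta_B$ invertible, $X_A\Delta_BX_A=\Delta_BX_A\Delta_B$ and $X_A\Delta_{B^T}X_A=\Delta_{B^T}X_A\Delta_{B^T}$; it is invertible if moreover $A$ has no zero entry and $B$ is invertible (equivalently $A,B$ type-II). For $P$ invertible and $Q$ without zero entries, $\mathcal N_{P,Q}$ is the set of matrices $M$ such that each $Pe_i\circ Qe_j$ is an eigenvector of $M$; for such $M$, $\Theta_{P,Q}(M)$ is the matrix with $M(Pe_i\circ Qe_j)=\Theta_{P,Q}(M)_{ij}(Pe_i\circ Qe_j)$. For type-II $P$,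 $\mathcal N_P:=\mathcal N_{P,P^{(-)}}$, $\Theta_P:=\Theta_{P,P^{(-)}}$. Standing facts (for an invertible Jones pair with $A$ symmetric) needed for the definitions: $\mathcal N_{A,B}=\mathcal N_{A,B^T}$ is closed under transposition and $\mathcal N_A=\mathcal N_{B^{(-)}}$. Pairing: for $H\in\mathcal N_{A,B}$, the matrix paired with $H$ is the unique $K$ with $K^T\in\mathcal N_{A,B^T}$ and $\Theta_{A,B}(H)=\Theta_{A,B^T}(K^T)^T$. For $F\in\mathcal N_A$, $G,H\in\mathcal N_{A,B}$, with $K$ paired with $H$, \[ \mathcal M(F,G,H)=\begin{pmatrix} \Theta_A(F)+H & \Theta_A(F)-H & \Theta_{A,B}(G) & \Theta_{A,B}(G)\\ \Theta_A(F)-H & \Theta_A(F)+H & \Theta_{A,B}(G) & \Theta_{A,B}(G)\\ \Theta_{A,B}(G^T)^T & \Theta_{A,B}(G^T)^T & \Theta_{B^{(-)}}(F)+K & \Theta_{B^{(-)}}(F)-K\\ \Theta_{A,B}(G^T)^T & \Theta_{A,B}(G^T)^T & \Theta_{B^{(-)}}(F)-K & \Theta_{B^{(-)}}(F)+K \end{pmatrix}. \] *)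

(* Defs.v *)
From HB Require Import structures.
From mathcomp Require Import all_boot all_order all_algebra.
From mathcomp Require Import complex.
From mathcomp Require Import boolp classical_sets reals.

Set Implicit Arguments.
Unset Strict Implicit.
Unset Printing Implicit Defensive.

Import GRing.Theory.
Local Open Scope ring_scope.
Local Open Scope classical_set_scope.

Definition schur_mul (K : fieldType) (m n : nat) (X Y : 'M[K]_(m, n)) :
    'M[K]_(m, n) :=
  map2_mx *%R X Y.

(* Entrywise [GRing.inv]: zero entries, excluded wherever this is used,
   would be sent to 0. *)
Definition schur_inv (K : fieldType) (m n : nat) (X : 'M[K]_(m, n)) :
    'M[K]_(m, n) :=
  map_mx GRing.inv X.

Definition no_zero_entry (K : fieldType) (m n : nat) (X : 'M[K]_(m, n)) : Prop :=
  forall i j, X i j != 0.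

Definition X_op (K : fieldType) (n : nat) (C M : 'M[K]_n) : 'M[K]_n :=
  C *m M.

Definition Delta_op (K : fieldType) (n : nat) (C M : 'M[K]_n) : 'M[K]_n :=
  schur_mul C M.

Definition Jones_pair (K : fieldType) (n : nat) (A B : 'M[K]_n) : Prop :=
  [/\ bijective (X_op A),
      bijective (Delta_op B),
      X_op A \o Delta_op B \o X_op A =1 Delta_op B \o X_op A \o Delta_op B
    & X_op A \o Delta_op B^T \o X_op A
        =1 Delta_op B^T \o X_op A \o Delta_op B^T].

Definition invertible_Jones_pair (K : fieldType) (n : nat) (A B : 'M[K]_n) :
    Prop :=
  [/\ Jones_pair A B, no_zero_entry A & B \in unitmx].

Definition eigenvector (K : fieldType) (n : nat) (M : 'M[K]_n) (v : 'cV[K]_n) :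
    Prop :=
  v != 0 /\ exists a : K, M *m v = a *: v.

Definition nomura_vec (K : fieldType) (n : nat) (P Q : 'M[K]_n) (i j : 'I_n) :
    'cV[K]_n :=
  schur_mul (col i P) (col j Q).

Definition Nomura2 (K : fieldType) (n : nat) (P Q : 'M[K]_n) : set 'M[K]_n :=
  [set M | forall i j, eigenvector M (nomura_vec P Q i j)].

(* Definite description: for P invertible, Q without zero entries and M in
   [Nomura2 P Q] there is exactly one such T; the default 0 is returned only
   if there is none. *)
Definition Theta2 (K : fieldType) (n : nat) (P Q M : 'M[K]_n) : 'M[K]_n :=
  xget 0 [set T : 'M[K]_n | forall i j,
    M *m nomura_vec P Q i j = T i j *: nomura_vec P Q i j].

Definition Nomura (K : fieldType) (n : nat) (P : 'M[K]_n) : set 'M[K]_n :=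
  Nomura2 P (schur_inv P).

Definition Theta (K : fieldType) (n : nat) (P M : 'M[K]_n) : 'M[K]_n :=
  Theta2 P (schur_inv P) M.

(* Definite description again: the K0 paired with H is unique since
   Theta_{A,B^T} is injective on [Nomura2 A B^T]. *)
Definition paired (K : fieldType) (n : nat) (A B H : 'M[K]_n) : 'M[K]_n :=
  xget 0 [set K0 : 'M[K]_n |
    Nomura2 A B^T K0^T /\ Theta2 A B H = (Theta2 A B^T K0^T)^T].

Definition M_mx (K : fieldType) (n : nat) (A B F G H : 'M[K]_n) :
    'M[K]_((n + n) + (n + n)) :=
  let TA := Theta A F in
  let TB := Theta (schur_inv B) F in
  let TG := Theta2 A B G in
  let TGt := (Theta2 A B G^T)^T in
  let K0 := paired A B H in
  block_mx
    (block_mx (TA + H) (TA - H)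
              (TA - H) (TA + H))     (block_mx TG TG
                                               TG TG)
    (block_mx TGt TGt
              TGt TGt)               (block_mx (TB + K0) (TB - K0)
                                               (TB - K0) (TB + K0)).

Definition calB (K : fieldType) (n : nat) (A B : 'M[K]_n) :
    set 'M[K]_((n + n) + (n + n)) :=
  [set X | exists F G H : 'M[K]_n,
    [/\ Nomura A F, Nomura2 A B G, Nomura2 A B H & X = M_mx A B F G H]].

Definition V_mx (K : fieldType) (n : nat) (d : K) (A B : 'M[K]_n) :
    'M[K]_((n + n) + (n + n)) :=
  let Bi := schur_inv B in
  block_mx
    (block_mx (d *: A) (- (d *: A))
              (- (d *: A)) (d *: A))     (block_mx Bi Bi
                                                   Bi Bi)
    (block_mx Bi^T Bi^T
              Bi^T Bi^T)                 (block_mx (d *: A) (- (d *: A))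
                                                   (- (d *: A)) (d *: A)).

(* Main.v *)
Require Import Defs.
From mathcomp Require Import all_boot all_order all_algebra.
From mathcomp Require Import complex.
From mathcomp Require Import boolp classical_sets reals.
Import GRing.Theory.
Local Open Scope ring_scope.
Local Open Scope complex_scope.

(** Evaluating the braid relation of a Jones pair on a matrix unit shows that
    [A] has eigenvalue [B i j] on [A e_i o B e_j], that is, [A] lies in the
    Nomura space of [(A, B)] with [Theta_{A,B}(A) = B]; likewise
    [Theta_{A,B^T}(A) = B^T].  As [A] is symmetric, [d A] is therefore paired
    with itself, and [V = M(0, A^-1, d A)]. *)

Section NomuraSpace.

Variables (K : fieldType) (n : nat).
Implicit Types A B P Q M T : 'M[K]_n.

Lemma col_mulmx P M j : col j (P *m M) = P *m col j M.
Proof. by rewrite !colE mulmxA. Qed.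

Lemma nomura_vec_neq0 P Q i j :
  no_zero_entry P -> no_zero_entry Q -> nomura_vec P Q i j != 0.
Proof.
move=> hP hQ; apply/eqP => /matrixP /(_ i 0); rewrite !mxE => /eqP.
by rewrite mulf_eq0 (negbTE (hP _ _)) (negbTE (hQ _ _)).
Qed.

Lemma no_zero_schur_inv P : no_zero_entry P -> no_zero_entry (schur_inv P).
Proof. by move=> hP i j; rewrite mxE invr_eq0. Qed.

Lemma no_zero_tr P : no_zero_entry P -> no_zero_entry P^T.
Proof. by move=> hP i j; rewrite mxE. Qed.

Lemma Nomura2_of_eigenvalues P Q M T :
  no_zero_entry P -> no_zero_entry Q ->
  (forall i j, M *m nomura_vec P Q i j = T i j *: nomura_vec P Q i j) ->
  Nomura2 P Q M.
Proof.
by move=> hP hQ hM i j; split; [exact: nomura_vec_neq0 | exists (T i j)].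
Qed.

(** A nonzero vector determines its eigenvalue, so any explicit table of eigenvalues is the one
    picked by [xget]. *)
Lemma Theta2_eq P Q M T :
  no_zero_entry P -> no_zero_entry Q ->
  (forall i j, M *m nomura_vec P Q i j = T i j *: nomura_vec P Q i j) ->
  Theta2 P Q M = T.
Proof.
move=> hP hQ hM; rewrite /Theta2; apply: xget_unique => // T' hT'.
apply/matrixP => i j.
have /eqP : T' i j *: nomura_vec P Q i j = T i j *: nomura_vec P Q i j.
  by rewrite -hM -hT'.
rewrite -subr_eq0 -scalerBl scaler_eq0 (negbTE (nomura_vec_neq0 _ _ i j hP hQ)).
by rewrite orbF subr_eq0 => /eqP.
Qed.

(** Eigenvalues chosen pair by pair assemble into a matrix, so the default 0 of [Theta2] is never
    reached on the Nomura space. *)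
Lemma Theta2P P Q M : Nomura2 P Q M ->
  forall i j, M *m nomura_vec P Q i j = Theta2 P Q M i j *: nomura_vec P Q i j.
Proof.
move=> hM.
have hM' i j : exists a, M *m nomura_vec P Q i j
    = a *: nomura_vec P Q i j by case: (hM i j).
pose T := \matrix_(i, j) sval (cid (hM' i j)).
apply: (@xgetPex _ 0 [set T : 'M[K]_n | forall i j,
  M *m nomura_vec P Q i j = T i j *: nomura_vec P Q i j]%classic).
by exists T => i j; rewrite mxE; exact: (svalP (cid (hM' i j))).
Qed.

(* For a fixed column of [Q] the vectors [P e_i o Q e_j] are the columns of
   [diag (Q e_j) P], hence form a basis. *)
Lemma Theta2_inj P Q M M' : P \in unitmx -> no_zero_entry Q ->
  Nomura2 P Q M -> Nomura2 P Q M' -> Theta2 P Q M = Theta2 P Q M' -> M = M'.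
Proof.
move=> uP hQ hM hM' eqT.
have eqv i j : M *m nomura_vec P Q i j = M' *m nomura_vec P Q i j.
  by rewrite !Theta2P // eqT.
(* Fixing a column of [Q] requires an index; for [n = 0] all matrices coincide. *)
have [j _|n0] := pickP (@predT 'I_n); last first.
  by apply/matrixP => i; have := n0 i.
pose D := diag_mx (\row_k Q k j).
have colD i : col i (D *m P) = nomura_vec P Q i j.
  by apply/colP => k; rewrite mul_diag_mx !mxE mulrC.
have uD : D \in unitmx.
  rewrite unitmxE det_diag unitfE; apply/prodf_neq0 => k _.
  by rewrite mxE.
have uDP : D *m P \in unitmx by rewrite unitmx_mul uD uP.
apply: (can_inj (mulmxK uDP)); apply/matrixP => k i.
by have /colP/(_ k) := eqv i j; rewrite -colD -!col_mulmx !mxE.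
Qed.

Lemma Theta2_0 P Q : no_zero_entry P -> no_zero_entry Q -> Theta2 P Q 0 = 0.
Proof.
by move=> hP hQ; apply: Theta2_eq => // i j; rewrite mul0mx mxE scale0r.
Qed.

Lemma Nomura2_0 P Q : no_zero_entry P -> no_zero_entry Q -> Nomura2 P Q 0.
Proof.
move=> hP hQ; apply: (Nomura2_of_eigenvalues _ _ _ 0) => // i j.
by rewrite mul0mx mxE scale0r.
Qed.

Lemma X_op_unitmx A : bijective (X_op A) -> A \in unitmx.
Proof. by case=> g _ /(_ 1%:M) /mulmx1_unit []. Qed.

(** A Schur preimage of the all-ones matrix rules out zero entries. *)
Lemma Delta_op_no_zero B : bijective (Delta_op B) -> no_zero_entry B.
Proof.
case=> g _ /(_ (const_mx 1)) /matrixP h i j.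
apply/eqP => B0; have := h i j; rewrite !mxE B0 mul0r => /eqP.
by rewrite eq_sym oner_eq0.
Qed.

Lemma braid_eigenvalues A B :
  X_op A \o Delta_op B \o X_op A =1 Delta_op B \o X_op A \o Delta_op B ->
  forall i j, A *m nomura_vec A B i j = B i j *: nomura_vec A B i j.
Proof.
move=> braid i j.
have colBA M : col j (schur_mul B (A *m M)) = schur_mul (col j B) (A *m col j M).
  by rewrite -col_mulmx; apply/colP => k; rewrite !mxE.
have colE1 : col j (delta_mx i j : 'M[K]_n) = delta_mx i 0.
  by apply/colP => k; rewrite !mxE !eqxx !andbT.
have colBE : col j (schur_mul B (delta_mx i j)) = B i j *: delta_mx i 0.
  apply/colP => k; rewrite !mxE !eqxx !andbT.
  by case: eqP => [->|_]; rewrite ?mulr0.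
have vE : nomura_vec A B i j = schur_mul (col j B) (col i A).
  by apply/colP => k; rewrite !mxE mulrC.
(* Both operators act column by column. On column j of the matrix unit, the left side gives A (B e_j
   o A e_i) and the right side gives B e_j o A (B_ij e_i). *)
have := congr1 (col j) (braid (delta_mx i j)).
rewrite /= /X_op /Delta_op col_mulmx !colBA colBE colE1 -scalemxAr -colE -vE => ->.
by apply/colP => k; rewrite vE !mxE mulrCA.
Qed.

(** Inverting a matrix inverts its eigenvalues on the same eigenvectors; for [M = A] and [T = B]
    this produces the blocks [schur_inv B] of V. *)
Lemma invmx_eigenvalues P Q M T : M \in unitmx -> no_zero_entry T ->
  (forall i j, M *m nomura_vec P Q i j = T i j *: nomura_vec P Q i j) ->
  forall i j, invmx M *m nomura_vec P Q i j
              = schur_inv T i j *: nomura_vec P Q i j.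
Proof.
move=> uM hT hM i j; apply: (can_inj (mulKmx uM)).
by rewrite mulKVmx // -scalemxAr hM scalerA mxE mulVf ?scale1r.
Qed.

Lemma scale_eigenvalues P Q M T d :
  (forall i j, M *m nomura_vec P Q i j = T i j *: nomura_vec P Q i j) ->
  forall i j, (d *: M) *m nomura_vec P Q i j
              = (d *: T) i j *: nomura_vec P Q i j.
Proof. by move=> hM i j; rewrite -scalemxAl hM scalerA mxE. Qed.

(** Uniqueness of the paired matrix comes from injectivity of Theta_{A,B^T}. *)
Lemma paired_eq A B H H' : A \in unitmx -> no_zero_entry B ->
  Nomura2 A B^T H'^T -> Theta2 A B H = (Theta2 A B^T H'^T)^T ->
  paired A B H = H'.
Proof.
move=> uA hB hH' eqH; apply: xget_unique => // L [hL eqL].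
apply: trmx_inj; apply: (Theta2_inj _ _ _ _ uA (no_zero_tr _ hB)) => //.
by apply: trmx_inj; rewrite -eqL.
Qed.

Lemma V_mx_in_calB A B d :
  invertible_Jones_pair A B -> A^T = A -> calB A B (V_mx d A B).
Proof.
case=> -[/X_op_unitmx uA /Delta_op_no_zero hB brAB brABt] hA _ symA.
have eAB := braid_eigenvalues _ _ brAB.
have edAB := scale_eigenvalues _ _ _ _ d eAB.
have edABt := scale_eigenvalues _ _ _ _ d (braid_eigenvalues _ _ brABt).
have eiAB := invmx_eigenvalues _ _ _ _ uA hB eAB.
have hBt := no_zero_tr _ hB.
have hBi := no_zero_schur_inv _ hB.
have symdA : (d *: A)^T = d *: A by rewrite linearZ /= symA.
have pairedA : paired A B (d *: A) = d *: A.
  apply: paired_eq => //; rewrite symdA.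
    exact: Nomura2_of_eigenvalues edABt.
  (* The two eigenvalue matrices of dA are dB and d B^T, transposes of each other. *)
  rewrite (Theta2_eq _ _ _ _ hA hB edAB) (Theta2_eq _ _ _ _ hA hBt edABt).
  by rewrite linearZ /= trmxK.
(* F = 0 leaves only H, K and their negatives in the diagonal blocks, while G must have
   Theta_{A,B}(G) = B^(-). *)
exists 0, (invmx A), (d *: A); split.
- by apply: Nomura2_0 => //; exact: no_zero_schur_inv.
- exact: Nomura2_of_eigenvalues eiAB.
- exact: Nomura2_of_eigenvalues edAB.
(* Since A^-1 is symmetric, Theta_{A,B}(G^T)^T is the transpose of B^(-), as the lower left blocks
   demand. *)
rewrite /M_mx /V_mx /Theta trmx_inv symA pairedA (Theta2_eq _ _ _ _ hA hB eiAB).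
by rewrite !Theta2_0 ?add0r ?sub0r //; exact: no_zero_schur_inv.
Qed.

End NomuraSpace.

Theorem theorem7p1 (R : realType) (n : nat) (A B : 'M[R[i]]_n) (d : R[i])
    (hAB : invertible_Jones_pair A B) (hA : A^T = A) (hd : d ^+ 2 = n%:R) :
  calB A B (V_mx d A B).
Proof. exact: V_mx_in_calB. Qed.
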